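(* Let $p\in(1,\infty)$ and $q\in[1,\infty]$. Then there exist constants $c_{p,q},C_{p,q}>0$ depending only on $p$ and $q$ such that for every $N\ge1$ and all $x_1,\ldots,x_N\in\mathbb{C}$, $$c_{p,q}\left\|\sum_{n=1}^N x_n r_n\right\|_{L^2}\le\left\|\sum_{n=1}^N x_n r_n\right\|_{L^{p,q}}\le C_{p,q}\left\|\sum_{n=1}^N x_n r_n\right\|_{L^2},\qquad \left\|\sum_{n=1}^N x_n r_n\right\|_{L^2}=\left(\sum_{n=1}^N|x_n|^2\right)^{1/2},$$ where $r_n(t)=\operatorname{sign}(\sin(2\pi 2^n t))$ is the $n$-th Rademacher function on $[0,1]$ and the norms are taken over $[0,1]$ with Lebesgue measure.
   Context: For a measure space $(X,\mu)$ and a measurable function $f$ on $X$, put $d_f(\lambda)=\mu(\{x\in X:|f(x)|>\lambda\})$ and let $f^*(t)=\inf\{\lambda>0:d_f(\lambda)\le t\}$ be the non-increasing rearrangement of $f$. For $p\in(1,\infty)$ and $q\in[1,\infty]$, the Lorentz space $L^{p,q}(X)$ consists of all measurable $f$ for which $$\|f\|_{L^{p,q}}=\begin{cases}\left(\int_0^\infty\left(t^{1/p}f^*(t)\right)^q\frac{dt}{t}\right)^{1/q}, & q<\infty,\\ \sup_{t>0}t^{1/p}f^*(t), & q=\infty,\end{cases}$$ is finite. *)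

(* Defs.v *)
From mathcomp Require Import all_boot all_order all_algebra.
From mathcomp Require Import all_classical all_reals all_analysis.
From mathcomp Require Import complex.

Set Implicit Arguments.
Unset Strict Implicit.
Unset Printing Implicit Defensive.

Import Order.TTheory GRing.Theory Num.Theory.
Import numFieldNormedType.Exports.

Local Open Scope classical_set_scope.
Local Open Scope ring_scope.

(* The modulus as an element of R: on R[i] itself, `|z| has type R[i]. *)
Definition cmod (R : realType) (z : R[i]) : R := ComplexField.Normc.normc z.

Section Lorentz.
Context d (T : measurableType d) (R : realType).
Variables (mu : {measure set T -> \bar R}) (f : T -> R[i]).
Local Open Scope ereal_scope.

Definition distr_fun (l : R) : \bar R := mu [set x | (l < cmod (f x))%R].

(* ereal_inf set0 = +oo, as in the usual convention inf set0 = +oo. *)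
Definition rearrangement (t : R) : \bar R :=
  ereal_inf [set l%:E | l in [set l : R | (0 < l)%R /\ distr_fun l <= t%:E]].

(* The value at q = -oo is a placeholder. *)
Definition lorentz_norm (p : R) (q : \bar R) : \bar R :=
  match q with
  | r%:E =>
      (\int[lebesgue_measure]_(t in `]0%R, +oo[)
         (((t `^ p^-1)%:E * rearrangement t) `^ r * (t^-1)%:E)) `^ r^-1
  | +oo =>
      ereal_sup [set (t `^ p^-1)%:E * rearrangement t | t in `]0%R, +oo[]
  | -oo => 0
  end.

Definition complex_Lnorm (p : \bar R) : \bar R :=
  Lnorm mu p (fun x => (cmod (f x))%:E).

End Lorentz.

Definition rademacher (R : realType) (n : nat) (t : R) : R :=
  Num.sg (sin (2 * pi * 2 ^+ n * t)).

(* x 0 is not used: the sum runs over n = 1, ..., N. *)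
Definition rademacher_sum (R : realType) (N : nat) (x : nat -> R[i]) (t : R) :
    R[i] :=
  \sum_(1 <= n < N.+1) x n * (rademacher n t)%:C%C.

(* Lebesgue measure on [0, 1], as a measure on R carried by [0, 1]. *)
Definition unit_lebesgue (R : realType) : {measure set _ -> \bar R} :=
  mrestr (@lebesgue_measure R) (measurable_itv `[0 : R, 1 : R]).

(* Main.v *)
Require Import Defs.
From mathcomp Require Import all_boot all_order all_algebra.
From mathcomp Require Import all_classical all_reals all_analysis complex.
From mathcomp Require Import measurable_realfun ring lra.

Set Implicit Arguments.
Unset Strict Implicit.
Unset Printing Implicit Defensive.

Import Order.TTheory GRing.Theory Num.Theory.
Import numFieldNormedType.Exports.

Local Open Scope classical_set_scope.
Local Open Scope ring_scope.

(** Translation by 2^-(m+1) modulo 1 preserves Lebesgue measure on [0, 1], flips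
    the sign of r_m and fixes r_n for n > m. Symmetrising over r_m, one index at
    a time, replaces independence: it gives E|S|^2 = sum |x_n|^2 and, since
    cosh b <= exp(2 b^2), E exp(sum a_n r_n) <= exp(2 sum a_n^2) for real a_n.
    Hence E exp(|S| / (2 sigma)) is bounded by an absolute constant as soon as
    sum |x_n|^2 <= sigma^2. Markov's inequality with a moment of order m > p then
    gives S^*(t) <= B sigma t^(-1/m), which together with S^* = 0 beyond t = 1
    bounds the Lorentz norm from above. From below, a Paley-Zygmund argument
    gives S^* >= ||S||_2 / 2 on an interval of absolute length. *)

(** * Translation modulo 1 on the unit interval *)

Lemma lebesgue_measureD (R : realType) (a : R) (A : set R) : measurable A ->
  lebesgue_measure ((fun x : measurableTypeR R => x + a) @^-1` A) =
  lebesgue_measure A.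
Proof.
move=> mA; pose f (x : measurableTypeR R) : measurableTypeR R := x + a.
have mf : measurable_fun setT f by exact: measurable_funD.
rewrite -[LHS]/(pushforward lebesgue_measure f A).
apply/esym/lebesgue_measure_unique => //= _ [[x y]] _ <-.
rewrite /pushforward /f.
have -> : (fun z => z + a) @^-1` `]x, y] = `]x - a, y - a]%classic.
  by apply/seteqP; split=> z /=; rewrite !in_itv/=; lra.
rewrite !lebesgue_measure_itv/= !lte_fin ltrD2r.
by rewrite -!EFinD opprB addrA subrK.
Qed.

(** Serves to discard endpoints when closed intervals are replaced by half-open ones. *)
Lemma lebesgue_measureI_null (R : realType) (A B N : set R) :
  measurable A -> measurable B -> measurable N ->
  lebesgue_measure N = 0%E ->
  lebesgue_measure (A `&` (B `|` N)) = lebesgue_measure (A `&` B).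
Proof.
move=> mA mB mN N0; rewrite setIUr measureU0//; try exact: measurableI.
apply/eqP; rewrite eq_le measure_ge0 andbT -N0.
by apply: le_measure; rewrite ?inE//; exact: measurableI.
Qed.

(** Translation modulo 1, written without a fractional part: for a and t in [0, 1] a single
    subtraction of 1 brings t + a back to [0, 1]. *)
Definition circle_shift (R : realType) (a : R) (t : measurableTypeR R) :
    measurableTypeR R :=
  if t < 1 - a then t + a else t + (a - 1).

Lemma measurable_circle_shift (R : realType) (a : R) :
  measurable_fun setT (circle_shift a).
Proof.
apply: measurable_fun_ifT => /=; [|exact: measurable_funD..].
exact: measurable_fun_ltr.
Qed.

(** Points of [0, 1] below 1 - a land in [a, 1[ and the others in [0, a]. The preimage is thus a
    disjoint union of two translates, and up to endpoints the two target intervals tile [0, 1]. *)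
Lemma unit_lebesgue_circle_shift (R : realType) (a : R) (A : set R) :
  0 <= a <= 1 -> measurable A ->
  pushforward (unit_lebesgue R) (circle_shift a) A = unit_lebesgue R A.
Proof.
move=> a01 mA; rewrite /pushforward /= /mrestr.
have -> : circle_shift a @^-1` A `&` `[0, 1] =
    (fun x => x + a) @^-1` (A `&` `[a, 1[) `|`
    (fun x => x + (a - 1)) @^-1` (A `&` `[0, a]).
  apply/seteqP; split=> t /=; rewrite /circle_shift !in_itv/=.
    by case: ltP => ta [At t01]; [left|right]; split=> //; lra.
  case=> -[At t01].
    by rewrite ifT; [split=> //; lra|lra].
  by rewrite ifF; [split=> //; lra|apply/negbTE; lra].
have mItv (b : R) (i : interval R) : measurable
    ((fun x : measurableTypeR R => x + b) @^-1` (A `&` [set` i])).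
  have mD : measurable_fun setT (fun x : measurableTypeR R => x + b).
    exact: measurable_funD.
  by rewrite -[X in measurable X]setTI; apply: mD => //; exact: measurableI.
rewrite measureU; [|exact: mItv|exact: mItv|]; last first.
  by rewrite -subset0 => t /=; rewrite !in_itv/= => -[[_ h1] [_ h2]]; lra.
rewrite /= !lebesgue_measureD; try exact: measurableI.
have -> : `[0, a]%classic = `[0, a[ `|` [set a].
  apply/seteqP; split=> t /=; rewrite !in_itv/=.
    by case: (eqVneq t a) => [|ta] h; [right|left; move/eqP: ta; lra].
  by case=> [|->]; lra.
have -> : `[0, 1]%classic = (`[a, 1[ `|` `[0, a[) `|` [set 1%R].
  apply/seteqP; split=> t /=; rewrite !in_itv/=.
    case: (eqVneq t 1) => [|t1] h; [by right|left].
    by case: (ltP t a) => ta; [right|left]; move/eqP: t1; lra.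
  by case=> [[]|->]; lra.
rewrite (@lebesgue_measureI_null _ A _ [set a])//;
  last exact: lebesgue_measure_set1.
rewrite (@lebesgue_measureI_null _ A _ [set 1%R])//; first last.
- exact: lebesgue_measure_set1.
- exact: measurableU.
rewrite setIUr measureU//; try exact: measurableI.
by rewrite -subset0 => t /=; rewrite !in_itv/= => -[[_ h1] [_ h2]]; lra.
Qed.

(** By periodicity g (t + a) = g ([circle_shift] a t), so the claim is a change of variables along a
    measure-preserving map. *)
Lemma integral_unit_lebesgue_shift (R : realType) (a : R) (g : R -> \bar R) :
  0 <= a <= 1 -> measurable_fun setT g -> (forall t, 0 <= g t)%E ->
  (forall t, g (t + 1)%R = g t) ->
  (\int[unit_lebesgue R]_t g (t + a)%R = \int[unit_lebesgue R]_t g t)%E.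
Proof.
move=> a01 mg g0 gper.
transitivity (\int[pushforward (unit_lebesgue R) (circle_shift a)]_t g t)%E.
  rewrite ge0_integral_pushforward//; last exact: measurable_circle_shift.
  apply: eq_integral => t _ /=; rewrite /circle_shift; case: ifP => // _.
  by rewrite -(gper (t + (a - 1))) -addrA subrK.
apply: eq_measure_integral => [|mS A mA _]; first exact: measurable_circle_shift.
exact: unit_lebesgue_circle_shift.
Qed.

(** * Symmetries and zeros of the Rademacher functions *)

Section rademacher_functions.
Context {R : realType}.
Implicit Types (n m : nat) (t : R).

Lemma measurable_sgr : measurable_fun setT (@Num.sg R).
Proof.
apply: nondecreasing_measurable => // x y xy.
by case: (sgrP x); case: (sgrP y); lra.
Qed.

Lemma measurable_rademacher n : measurable_fun setT (@rademacher R n).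
Proof.
apply: measurableT_comp; first exact: measurable_sgr.
apply: measurableT_comp; last exact: measurable_funM.
by apply: continuous_measurable_fun => x; exact: continuous_sin.
Qed.

Lemma rademacher_halfperiod n t :
  rademacher n (t + 2^-1 ^+ n.+1) = - rademacher n t.
Proof.
rewrite /rademacher mulrDr.
have -> : 2 * pi * 2 ^+ n * 2^-1 ^+ n.+1 = pi :> R.
  rewrite exprS exprVn; field; rewrite expf_neq0//.
by rewrite sinDpi sgrN.
Qed.

(** The argument of the sine grows by 2^(n - m - 1) full turns. *)
Lemma rademacher_periodic n m t : (m < n)%N ->
  rademacher n (t + 2^-1 ^+ m.+1) = rademacher n t.
Proof.
move=> mn; rewrite /rademacher mulrDr.
have -> : 2 * pi * 2 ^+ n * 2^-1 ^+ m.+1 = pi *+ 2 *+ (2 ^ (n - m.+1)) :> R.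
  rewrite -{1}(subnK mn) exprD exprVn.
  rewrite -[in RHS]mulr_natl natrX -mulr_natl; field; rewrite expf_neq0//.
by rewrite (periodicn (@sinD2pi R)).
Qed.

Lemma rademacher_periodic1 n t : rademacher n (t + 1) = rademacher n t.
Proof.
rewrite /rademacher mulrDr mulr1.
have -> : 2 * pi * 2 ^+ n = pi *+ 2 *+ (2 ^ n) :> R.
  by rewrite -[in RHS]mulr_natl natrX -mulr_natl; ring.
by rewrite (periodicn (@sinD2pi R)).
Qed.

Lemma norm_rademacher_le1 n t : `|rademacher n t| <= 1.
Proof. by rewrite /rademacher normr_sg; case: (_ != 0). Qed.

(** With k the integer part of x / pi, the point x - k pi lies in [0, pi[, where the sine vanishes
    only at 0. *)
Lemma sin_eq0_nat (x : R) : 0 <= x -> sin x = 0 -> exists k : nat, x = pi *+ k.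
Proof.
move=> x0 sx0; have pi0 := @pi_gt0 R.
have [k1 k2] : x / pi < (Num.truncn (x / pi)).+1%:R /\
    (Num.truncn (x / pi))%:R <= x / pi.
  have /andP[] := @truncn_itv _ (x / pi) (divr_ge0 x0 (ltW pi0)).
  by split.
set k := Num.truncn _ in k1 k2; exists k.
have {}k1 : x < k.+1%:R * pi by rewrite -ltr_pdivrMr.
have {}k2 : k%:R * pi <= x by rewrite -ler_pdivlMr.
have : sin (x - pi *+ k) = 0.
  have := alternatingn (@sinDpi R) k (x - pi *+ k).
  rewrite subrK sx0 => /esym/eqP; rewrite mulf_eq0 signr_eq0/=.
  by move/eqP.
have [xk|xk] := leP x (pi *+ k).
  by move=> _; apply/eqP; rewrite eq_le xk/= -mulr_natl.
move=> sk; have : 0 < sin (x - pi *+ k).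
  apply: sin_gt0_pi; rewrite subr_gt0 xk/= -mulr_natl ltrBlDr.
  by move: k1; rewrite -natr1 mulrDl mul1r addrC.
by rewrite sk ltxx.
Qed.

(** The zeros in [0, 1] are among the points k / 2^(n+1), which are countably many. Since the sign
    of 0 is 0, the identity r_n^2 = 1 holds only off this set. *)
Lemma unit_lebesgue_rademacher_eq0 n :
  unit_lebesgue R [set t | rademacher n t = 0] = 0%E.
Proof.
rewrite /= /mrestr; apply: countable_lebesgue_measure0.
apply: (@sub_countable _ _ _ (range (fun k : nat => k%:R / (2 * 2 ^+ n) : R))).
  apply: subset_card_le => t /= []; rewrite in_itv/= => rt /andP[t0 t1].
  have /eqP := rt; rewrite sgr_eq0 => /eqP st.
  have [|k] := sin_eq0_nat _ st.
    by rewrite !mulr_ge0// ?pi_ge0 ?exprn_ge0.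
  move=> e; exists k => //.
  have pi0 := @pi_gt0 R.
  have p2 : (2 : R) ^+ n != 0 by rewrite expf_neq0.
  apply: (mulfI (_ : pi != 0)); first by rewrite gt_eqF.
  by rewrite mulrA mulr_natr -e; field.
exact: card_image_le.
Qed.

End rademacher_functions.

(** * Exponential and second moments of real Rademacher sums *)

Section rademacher_expectation.
Context {R : realType}.
Local Notation E := (fun g : R -> R => (\int[unit_lebesgue R]_t (g t)%:E)%E).

Lemma unit_lebesgueT : unit_lebesgue R setT = 1%E.
Proof.
by rewrite /= /mrestr setTI lebesgue_measure_itv/= lte_fin ltr01 oppr0 adde0.
Qed.

(* phi carries the dependence on the r_n with n > m, whence the periodicity. *)
Lemma rademacher_symmetrize (m : nat) (phi : R -> R -> R) :
  measurable_fun setT (fun t => phi (rademacher m t) t) ->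
  (forall u t, 0 <= phi u t) ->
  (forall u t, phi u (t + 2^-1 ^+ m.+1) = phi u t) ->
  E (fun t => phi (rademacher m t) t) =
  E (fun t => (phi (rademacher m t) t + phi (- rademacher m t) t) / 2).
Proof.
move=> mphi phi0 phiper; set a : R := 2^-1 ^+ m.+1.
pose g t := (phi (rademacher m t) t / 2)%:E.
have a01 : 0 <= a <= 1.
  by rewrite exprn_ge0//= exprn_ile1// invf_le1// ler1n.
have g0 t : (0 <= g t)%E by rewrite lee_fin divr_ge0.
have mg : measurable_fun setT g.
  by apply/measurable_EFinP; exact: measurable_funM.
have ga t : g (t + a) = (phi (- rademacher m t) t / 2)%:E.
  by rewrite /g rademacher_halfperiod phiper.
have mga : measurable_fun setT (fun t : R => g (t + a)).
  by apply: measurableT_comp => //; exact: measurable_funD.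
have gper t : g (t + 1) = g t.
  rewrite /g rademacher_periodic1.
  have -> : t + 1 = t + a *+ (2 ^ m.+1).
    by rewrite -mulr_natl natrX /a exprVn mulfV// expf_neq0.
  by rewrite (periodicn (phiper _)).
(* One half of the integrand is kept; the other is translated by a, which flips the sign of r_m and
   leaves phi unchanged in its second argument. *)
transitivity (\int[unit_lebesgue R]_t (g t + g t))%E.
  by apply: eq_integral => t _; rewrite -EFinD -splitr.
rewrite ge0_integralD//.
rewrite -[X in (_ + X)%E](integral_unit_lebesgue_shift a01)//.
rewrite -ge0_integralD//.
  by apply: eq_integral => t _; rewrite ga -EFinD mulrDl.
Qed.

(** This is cosh b <= exp (2 b^2). The generous factor 2 allows a proof from 1 + x <= exp x: for 0
    <= b <= 1/2 the left side is at most 2 + 3 b^2, and for b > 1/2 one has b <= 2 b^2. *)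
Lemma expRD_expRN_le (b : R) : expR b + expR (- b) <= 2 * expR (2 * b ^+ 2).
Proof.
wlog b0 : b / 0 <= b.
  move=> H; have [/H//|/ltW b0] := leP 0 b.
  by have := H (- b); rewrite opprK sqrrN addrC oppr_ge0; exact.
have XY : expR b * expR (- b) = 1 by rewrite -expRD subrr expR0.
have X0 := expR_gt0 b; have Y0 := expR_gt0 (- b).
have [b2|b2] := leP b (2^-1).
  have X1 := expR_ge1Dx b; have Y1 := expR_ge1Dx (- b).
  have Z1 := expR_ge1Dx (2 * b ^+ 2).
  have X2 : expR b * (1 - b) <= 1 by nra.
  have Y2 : expR (- b) * (1 + b) <= 1 by nra.
  have X3 : expR b <= 1 + b + 2 * b ^+ 2.
    rewrite -(ler_pM2r (_ : 0 < 1 - b)); last lra.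
    apply: (le_trans X2).
    have -> : (1 + b + 2 * b ^+ 2) * (1 - b) = 1 + b ^+ 2 * (1 - 2 * b) by ring.
    by rewrite lerDl mulr_ge0 ?sqr_ge0//; lra.
  have Y3 : expR (- b) <= 1 - b + b ^+ 2.
    rewrite -(ler_pM2r (_ : 0 < 1 + b)); last lra.
    apply: (le_trans Y2).
    have -> : (1 - b + b ^+ 2) * (1 + b) = 1 + b ^+ 3 by ring.
    by rewrite lerDl exprn_ge0.
  have b22 := sqr_ge0 b; lra.
have H1 : expR b <= expR (2 * b ^+ 2) by rewrite ler_expR; nra.
have H2 : expR (- b) <= expR (2 * b ^+ 2) by rewrite ler_expR; nra.
lra.
Qed.

(** The lower index m is free because inductions remove the first term: the translation that flips
    r_m fixes only the later r_n. *)
Definition rsum (a : nat -> R) (m M : nat) (t : R) : R :=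
  \sum_(m <= n < M) a n * rademacher n t.

Lemma measurable_rsum a m M : measurable_fun setT (rsum a m M).
Proof.
rewrite /rsum; apply: measurable_sum => n.
by apply: measurable_funM => //; exact: measurable_rademacher.
Qed.

Lemma rsum_periodic a m M t : rsum a m.+1 M (t + 2^-1 ^+ m.+1) = rsum a m.+1 M t.
Proof.
by apply: eq_big_nat => n /andP[mn _]; rewrite rademacher_periodic.
Qed.

Lemma rsum_recl a m k t : rsum a m (m + k.+1) t =
  a m * rademacher m t + rsum a m.+1 (m.+1 + k) t.
Proof. by rewrite /rsum big_ltn ?addnS ?addSn// ltnS leq_addr. Qed.

(** Induction on the number of terms: symmetrising over r_m replaces the factor exp (a_m r_m) by its
    hyperbolic cosine, which is at most the constant exp (2 a_m^2). *)
Lemma integral_expR_rsum_le a m k :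
  (E (fun t => expR (rsum a m (m + k) t)) <=
   (expR (2 * \sum_(m <= n < m + k) a n ^+ 2))%:E)%E.
Proof.
elim: k m => [|k IHk] m.
  rewrite addn0 big_geq// mulr0 expR0.
  under eq_integral do rewrite /rsum big_geq// expR0.
  by rewrite integral_cst//= unit_lebesgueT mule1.
under eq_integral do rewrite rsum_recl.
have mT := measurable_rsum a m.+1 (m.+1 + k).
set T := rsum a m.+1 _ in mT *.
have mr := @measurable_rademacher R m.
rewrite (@rademacher_symmetrize m (fun u t => expR (a m * u + T t)))//; first last.
- by move=> u t; rewrite /T rsum_periodic.
- apply: measurableT_comp => //; apply: measurable_funD => //.
  exact: measurable_funM.
apply: (@le_trans _ _
    (\int[unit_lebesgue R]_t ((expR (2 * a m ^+ 2))%:E * (expR (T t))%:E))%E).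
  apply: ge0_le_integral => //.
  - apply/measurable_EFinP; apply: measurable_funM => //.
    apply: measurable_funD; apply: measurableT_comp => //;
      apply: measurable_funD => //; apply: measurable_funM => //.
    exact: measurable_funN.
  - apply/measurable_EFinP; apply: measurable_funM => //.
    exact: measurableT_comp.
  (* The constant comes from (a_m r_m)^2 <= a_m^2, as |r_m| <= 1. *)
  - move=> t _; rewrite -EFinM lee_fin ler_pdivrMr// !expRD mulrN -mulrDl.
    rewrite [leRHS]mulrAC ler_wpM2r ?expR_ge0// [leRHS]mulrC.
    apply: (le_trans (expRD_expRN_le _)).
    rewrite ler_wpM2l// ler_expR ler_wpM2l//.
    rewrite exprMn ler_piMr ?sqr_ge0// -real_normK ?num_real//.
    by rewrite exprn_ile1// norm_rademacher_le1.
rewrite ge0_integralZl//; last first.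
  by apply/measurable_EFinP; exact: measurableT_comp.
rewrite -addSnnS big_ltn ?leq_addr// mulrDr expRD EFinM.
by rewrite lee_pmul2l ?lte_fin ?expR_gt0//; exact: IHk.
Qed.

(** Symmetrising over r_m cancels the cross term 2 a_m r_m T. What remains of the first term is
    a_m^2 r_m^2, equal to a_m^2 off the null set of zeros of r_m. *)
Lemma integral_sqr_rsum a m k :
  E (fun t => rsum a m (m + k) t ^+ 2) = (\sum_(m <= n < m + k) a n ^+ 2)%:E.
Proof.
elim: k m => [|k IHk] m.
  rewrite addn0 big_geq//.
  under eq_integral do rewrite /rsum big_geq// expr0n/=.
  by rewrite integral0.
under eq_integral do rewrite rsum_recl.
have mT := measurable_rsum a m.+1 (m.+1 + k).
set T := rsum a m.+1 _ in mT *.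
have mr := @measurable_rademacher R m.
rewrite (@rademacher_symmetrize m (fun u t => (a m * u + T t) ^+ 2))//; first last.
- by move=> u t; rewrite /T rsum_periodic.
- by move=> u t; exact: sqr_ge0.
- apply: measurable_funX => //; apply: measurable_funD => //.
  exact: measurable_funM.
transitivity (\int[unit_lebesgue R]_t
    (((a m * rademacher m t) ^+ 2)%:E + (T t ^+ 2)%:E))%E.
  by apply: eq_integral => t _; rewrite -EFinD; congr EFin; field.
rewrite ge0_integralD//; first last.
- by apply/measurable_EFinP; exact: measurable_funX.
- by move=> t _; rewrite lee_fin sqr_ge0.
- by apply/measurable_EFinP; apply: measurable_funX; exact: measurable_funM.
- by move=> t _; rewrite lee_fin sqr_ge0.
rewrite (IHk m.+1) -addSnnS [in RHS]big_ltn ?leq_addr// EFinD.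
congr (_ + _)%E.
transitivity (\int[unit_lebesgue R]_t (cst (a m ^+ 2)%:E t))%E.
  apply: ge0_ae_eq_integral => //.
  - by apply/measurable_EFinP; apply: measurable_funX; exact: measurable_funM.
  - by move=> t _; rewrite lee_fin sqr_ge0.
  - by move=> t _; rewrite lee_fin sqr_ge0.
  exists [set t | rademacher m t = 0]; split.
  - by have := mr measurableT [set 0] (measurable_set1 0); rewrite setTI.
  - exact: unit_lebesgue_rademacher_eq0.
  - move=> t /=; apply: contra_notP => /eqP rt _ /=.
    rewrite exprMn; congr EFin.
    by rewrite -[rademacher m t ^+ 2]real_normK ?num_real// /rademacher normr_sg
      -sgr_eq0 rt expr1n mulr1.
by rewrite integral_cst// unit_lebesgueT mule1.
Qed.

End rademacher_expectation.

(** * Comparison of nonnegative integrals, and a power integral on ]0, 1] *)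

(** The integral of a nonnegative function is a supremum over the simple functions below it, which
    grows with the function. It serves in particular for Lorentz integrands, as measurability of
    [rearrangement] is not established. *)
Lemma ge0_le_integral_nonmeasurable d (T : measurableType d) (R : realType)
    (mu : {measure set T -> \bar R}) (D : set T) (f g : T -> \bar R) :
  (forall x, D x -> 0 <= f x)%E -> (forall x, D x -> f x <= g x)%E ->
  (\int[mu]_(x in D) f x <= \int[mu]_(x in D) g x)%E.
Proof.
move=> f0 fg.
rewrite !ge0_integralE//; last by move=> x Dx; exact: le_trans (f0 _ Dx) (fg _ Dx).
apply: ereal_sup_le => _ [h hf <-]; exists h => // x.
by apply: (le_trans (hf x)); exact: lee_restrict.
Qed.

(** The integrand may blow up at 0, so ]0, 1] is exhausted by the intervals [1/(n+2), 1]. On each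
    the primitive t^a / a gives at most 1/a, and monotone convergence concludes. The shift by 2
    keeps every interval nondegenerate. *)
Lemma integral_powR_itv01_le (R : realType) (a : R) : 0 < a ->
  (\int[lebesgue_measure]_(t in `]0%R, 1%R]) (t `^ (a - 1))%:E <= (a^-1)%:E)%E.
Proof.
move=> a0; pose F (n : nat) : set R := `[n.+2%:R^-1, 1]%classic.
have n0 n : 0 < n.+2%:R^-1 :> R by rewrite invr_gt0.
have n1 n : n.+2%:R^-1 < 1 :> R by rewrite invf_lt1// ltr1n.
have UF : \bigcup_n F n = `]0, 1]%classic.
  apply/seteqP; split=> [t [n _] /=|t /=]; rewrite /F/= !in_itv/=.
    by move=> /andP[nt ->]; rewrite (lt_le_trans (n0 n) nt).
  move=> /andP[t0 t1]; exists (Num.truncn t^-1) => //=.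
  rewrite in_itv/= t1 andbT invf_ple ?posrE//.
  have /andP[_ /ltW h] := @truncn_itv _ t^-1 (ltW (etrans (invr_gt0 t) t0)).
  by rewrite (le_trans h)// ler_nat.
rewrite -UF.
have der (x : R) : 0 < x -> is_derive x 1 (fun t : R => a^-1 * t `^ a) (x `^ (a - 1)).
  move=> x0; have dx := is_derive1_powR a x0.
  have -> : (fun t : R => a^-1 * t `^ a) = a^-1 \*: (@powR R ^~ a) by [].
  apply: is_derive_eq.
  by rewrite /GRing.scale/= mulrA mulVf ?gt_eqF// mul1r.
have cF : (\int[lebesgue_measure]_(t in F n) (t `^ (a - 1))%:E @[n --> \oo] -->
    \int[lebesgue_measure]_(t in \bigcup_n F n) (t `^ (a - 1))%:E)%E.
  apply: ge0_nondecreasing_set_cvg_integral => //.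
  - move=> m n mn; apply/subsetPset => t; rewrite /F/= !in_itv/= => /andP[+ ->].
    by rewrite andbT; apply: le_trans; rewrite lef_pV2 ?posrE// ler_nat !ltnS.
  - by move=> n; exact: measurable_itv.
  - move=> n; apply/measurable_EFinP; apply: measurable_funTS.
    exact: measurable_powR.
  - by move=> n t _; rewrite lee_fin powR_ge0.
rewrite -(cvg_lim _ cF)//; apply: lime_le; first by apply/cvg_ex; eexists; exact: cF.
apply: nearW => n.
rewrite (@continuous_FTC2 _ _ (fun t : R => a^-1 * t `^ a))//.
- rewrite powR1 mulr1 -EFinB lee_fin gerBl mulr_ge0 ?powR_ge0 ?invr_ge0// ltW//.
- apply: continuous_in_subspaceT => t; rewrite inE/= in_itv/= => /andP[nt _].
  apply: differentiable_continuous; apply/derivable1_diffP.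
  by apply: derivable_powR; rewrite in_itv/= andbT (lt_le_trans (n0 n)).
- have cont t : 0 < t -> {for t, continuous (fun t : R => a^-1 * t `^ a)}.
    move=> t0; apply: differentiable_continuous; apply/derivable1_diffP.
    by apply: ex_derive; exact: der.
  split.
  + move=> t; rewrite in_itv/= => /andP[nt _].
    by apply: ex_derive; apply: der; exact: lt_trans nt.
  + by apply: cvg_at_right_filter; exact: cont.
  + by apply: cvg_at_left_filter; exact: cont.
- move=> t; rewrite in_itv/= => /andP[nt _].
  by rewrite derive1E; have [_ ->] := der t (lt_trans (n0 n) nt).
Qed.

(** * Lorentz norm bounds from pointwise bounds on the rearrangement *)

Section lorentz_bounds.
Context {R : realType}.

Lemma ge0_ler_poweR (r : R) (x y : \bar R) :
  0 <= r -> (0 <= x -> x <= y -> x `^ r <= y `^ r)%E.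
Proof.
by move=> r0 x0 xy; apply: gt0_ler_poweR => //; rewrite in_itv/= leey andbT//;
  exact: le_trans xy.
Qed.

Lemma rearrangement_ge0 d (T : measurableType d) (mu : {measure set T -> \bar R})
  (f : T -> R[i]) t : (0 <= rearrangement mu f t)%E.
Proof. by apply: le_ereal_inf_tmp => _ [l [/ltW l0 _] <-]; rewrite lee_fin. Qed.

Lemma rearrangement_le d (T : measurableType d) (mu : {measure set T -> \bar R})
    (f : T -> R[i]) (l t : R) :
  0 < l -> (distr_fun mu f l <= t%:E)%E -> (rearrangement mu f t <= l%:E)%E.
Proof. by move=> l0 lt; apply: ereal_inf_lbound; exists l. Qed.

(** For finite q = r the integral reduces to B^r times that of t^(a - 1) over ]0, 1] with a = r (1/p
    - b), positive since b < 1/p; hence C = a^(-1/r). For infinite q, t^(1/p - b) <= 1 on ]0, 1]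
    gives C = 1. C precedes the measure space and f, which makes it uniform. *)
Lemma lorentz_norm_le (p : R) (q : \bar R) (b : R) :
  0 < p -> (1%:E <= q)%E -> b < p^-1 ->
  exists2 C : R, 0 < C &
    forall d (T : measurableType d) (mu : {measure set T -> \bar R})
      (f : T -> R[i]) (B : R), 0 <= B ->
    (forall t, (0 < t)%R -> rearrangement mu f t <= (B * t `^ (- b))%R%:E)%E ->
    (forall t, (1 < t)%R -> rearrangement mu f t = 0)%E ->
    (lorentz_norm mu f p q <= (C * B)%R%:E)%E.
Proof.
move=> p0 + bp; case: q => [r q1|_|//].
- rewrite lee_fin in q1; have r0 : 0 < r by exact: lt_le_trans q1.
  pose a := r * (p^-1 - b).
  have a0 : 0 < a by rewrite mulr_gt0// subr_gt0.
  exists (a^-1 `^ r^-1); first by rewrite powR_gt0// invr_gt0.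
  move=> d T mu f B B0 fB f0; rewrite /lorentz_norm.
  have -> : (a^-1 `^ r^-1 * B)%:E = ((B `^ r * a^-1)%R%:E `^ r^-1)%E.
    rewrite poweR_EFin powRM ?powR_ge0 ?invr_ge0 ?ltW// -powRrM mulfV ?gt_eqF//.
    by rewrite powRr1// mulrC.
  apply: ge0_ler_poweR; first by rewrite invr_ge0 ltW.
    apply: integral_ge0 => t; rewrite /= in_itv/= andbT => t0.
    by rewrite mule_ge0 ?poweR_ge0// lee_fin invr_ge0 ltW.
  pose g (t : R) := ((B `^ r)%R%:E * (t `^ (a - 1))%R%:E)%E.
  apply: (@le_trans _ _
      (\int[lebesgue_measure]_(t in `]0%R, +oo[) (g \_ `]0%R, 1%R]) t)%E).
    apply: ge0_le_integral_nonmeasurable => t; rewrite /= in_itv/= andbT => t0.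
      by rewrite mule_ge0 ?poweR_ge0// lee_fin invr_ge0 ltW.
    rewrite patchE; case: ifPn => t1; last first.
      have t1' : 1 < t.
        by rewrite ltNge; apply: contra t1 => t1; rewrite inE/= in_itv/= t0.
      by rewrite f0// mule0 poweR0r ?gt_eqF// mul0e.
    have tN0 : t != 0 by rewrite gt_eqF.
    have -> : g t = ((((t `^ p^-1)%R%:E * (B * t `^ (- b))%R%:E) `^ r) * (t^-1)%R%:E)%E.
      rewrite /g -EFinM poweR_EFin -!EFinM; congr EFin.
      rewrite mulrCA powRM ?mulr_ge0 ?powR_ge0// -mulrA; congr *%R.
      rewrite -powRD; last by rewrite tN0 implybT.
      rewrite -powRrM [_ * r]mulrC -/a -powR_inv1; last exact: ltW.
      by rewrite -powRD// tN0 implybT.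
    apply: lee_wpmul2r; first by rewrite lee_fin invr_ge0 ltW.
    apply: ge0_ler_poweR; first exact: ltW.
      by rewrite mule_ge0 ?lee_fin ?powR_ge0// rearrangement_ge0.
    by apply: lee_wpmul2l; [rewrite lee_fin powR_ge0|exact: fB].
  rewrite -integral_mkcondr (_ : _ `&` _ = `]0, 1]%classic); last first.
    by apply/seteqP; split=> t /=; rewrite !in_itv/= ?andbT; lra.
  rewrite ge0_integralZl//; first last.
  + by rewrite lee_fin powR_ge0.
  + by move=> t _; rewrite lee_fin powR_ge0.
  + apply/measurable_EFinP; apply: measurable_funTS; exact: measurable_powR.
  by rewrite EFinM lee_pmul ?lee_fin ?powR_ge0// ?integral_powR_itv01_le//;
    apply: integral_ge0 => t _; rewrite lee_fin powR_ge0.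
- exists 1 => // d T mu f B B0 fB f0; rewrite mul1r /=.
  apply: ge_ereal_sup => _ [t + <-]; rewrite /= in_itv/= andbT => t0.
  have tN0 : t != 0 by rewrite gt_eqF.
  have [t1|t1] := leP t 1; last by rewrite f0// mule0 lee_fin.
  apply: (@le_trans _ _ ((t `^ p^-1)%R%:E * (B * t `^ (- b))%R%:E)%E).
    by apply: lee_wpmul2l; [rewrite lee_fin powR_ge0|exact: fB].
  rewrite -EFinM lee_fin mulrCA -powRD; last by rewrite tN0 implybT.
  rewrite ler_piMr// -(powRr0 t) ger_powR ?t0 ?t1//.
  by rewrite subr_ge0 ltW.
Qed.

(** Only ]c0/2, c0[ is retained. There t^(1/p) >= k and 1/t >= 1/c0, so for finite q = r the
    integral is at least (k B)^r / 2. For infinite q the point c0/2 suffices. *)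
Lemma lorentz_norm_ge (p : R) (q : \bar R) (c0 : R) :
  0 < p -> (1%:E <= q)%E -> 0 < c0 ->
  exists2 c : R, 0 < c &
    forall d (T : measurableType d) (mu : {measure set T -> \bar R})
      (f : T -> R[i]) (B : R), 0 <= B ->
    (forall t, (0 < t < c0)%R -> B%:E <= rearrangement mu f t)%E ->
    ((c * B)%R%:E <= lorentz_norm mu f p q)%E.
Proof.
move=> p0 q1 c0_gt0; pose k := (c0 / 2) `^ p^-1.
have k0 : 0 < k by rewrite powR_gt0// divr_gt0.
have kt t : c0 / 2 <= t -> k <= t `^ p^-1.
  move=> ct; apply: ge0_ler_powR => //; rewrite ?nnegrE ?invr_ge0 ?ltW//.
    by rewrite divr_gt0.
  by rewrite (lt_le_trans _ ct)// divr_gt0.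
case: q q1 => [r q1|_|//].
- rewrite lee_fin in q1; have r0 : 0 < r by exact: lt_le_trans q1.
  exists (2^-1 `^ r^-1 * k); first by rewrite mulr_gt0// powR_gt0.
  move=> d T mu f B B0 fB; rewrite /lorentz_norm.
  have -> : (2^-1 `^ r^-1 * k * B)%:E = (((k * B) `^ r * 2^-1)%R%:E `^ r^-1)%E.
    rewrite poweR_EFin powRM ?powR_ge0 ?invr_ge0// -powRrM mulfV ?gt_eqF//.
    by rewrite powRr1 ?mulr_ge0 ?(ltW k0)//; congr EFin; ring.
  apply: ge0_ler_poweR; first by rewrite invr_ge0 ltW.
    by rewrite lee_fin mulr_ge0 ?powR_ge0.
  pose g (t : R) := ((k * B) `^ r * c0^-1)%:E.
  apply: (@le_trans _ _
      (\int[lebesgue_measure]_(t in `]0%R, +oo[) (g \_ `](c0 / 2)%R, c0[) t)%E).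
    rewrite -integral_mkcondr (_ : _ `&` _ = `]c0 / 2, c0[%classic); last first.
      by apply/seteqP; split=> t /=; rewrite !in_itv/= ?andbT; lra.
    rewrite integral_cst//= lebesgue_measure_itv/= lte_fin ifT; last lra.
    by rewrite -EFinB -EFinM lee_fin -mulrA ler_wpM2l ?powR_ge0//; 
      rewrite [leRHS](_ : _ = 2^-1)//; field; rewrite gt_eqF.
  apply: ge0_le_integral_nonmeasurable => t; rewrite /= in_itv/= andbT => t0.
    apply: erestrict_ge0 => s _.
    by rewrite lee_fin mulr_ge0 ?powR_ge0// invr_ge0 ltW.
  rewrite patchE; case: ifPn => t1; last first.
    by rewrite mule_ge0 ?poweR_ge0// lee_fin invr_ge0 ltW.
  move: t1; rewrite inE/= in_itv/= => /andP[ct tc].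
  rewrite /g EFinM; apply: lee_pmul; rewrite ?lee_fin ?powR_ge0 ?invr_ge0 ?(ltW c0_gt0)//.
    rewrite -poweR_EFin; apply: ge0_ler_poweR; first exact: ltW.
      by rewrite lee_fin mulr_ge0// ltW.
    rewrite EFinM; apply: lee_pmul; rewrite ?lee_fin ?(ltW k0)//.
      by apply: kt; exact: ltW.
    by apply: fB; rewrite t0.
  by rewrite lef_pV2// ltW.
- exists k => // d T mu f B B0 fB /=.
  apply: (@le_trans _ _ (((c0 / 2) `^ p^-1)%R%:E * rearrangement mu f (c0 / 2))%E).
    rewrite EFinM; apply: lee_wpmul2l; first by rewrite lee_fin ltW.
    by apply: fB; lra.
  by apply: ereal_sup_ubound; exists (c0 / 2) => //=; rewrite in_itv/= andbT divr_gt0.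
Qed.

End lorentz_bounds.

(** * The rearrangement under an exponential moment bound *)

Section rearrangement_bounds.
Context d (T : measurableType d) (R : realType).
Variables (mu : {measure set T -> \bar R}) (f : T -> R[i]) (sigma K : R).
Hypotheses (mf : measurable_fun setT (fun t => cmod (f t))).
Hypotheses (sigma0 : 0 < sigma) (K0 : 0 < K).
Hypothesis intK :
  (\int[mu]_t (expR (cmod (f t) / (2 * sigma)))%:E <= K%:E)%E.

Let measurable_gt (l : R) : measurable [set t | l < cmod (f t)].
Proof.
by rewrite -[X in measurable X]setTI; apply: measurable_fun_ltr.
Qed.

Let mexp : measurable_fun setT
  (fun t => (expR (cmod (f t) / (2 * sigma)))%:E).
Proof.
apply/measurable_EFinP; apply: measurableT_comp => //.
exact: measurable_funM.
Qed.

(** Markov's inequality for the exponential at height K / t bounds the measure by t. Since exp z >=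
    z^(m+1) / (m+1)!, that height is reached wherever |f| > 2 sigma y, with y as below. *)
Lemma rearrangement_le_powR (m : nat) (t : R) : 0 < t ->
  (rearrangement mu f t <=
   (2 * (K * m.+1`!%:R) `^ m.+1%:R^-1 * sigma * t `^ (- m.+1%:R^-1))%R%:E)%E.
Proof.
move=> t0; have M0 : 0 < m.+1`!%:R :> R by rewrite ltr0n fact_gt0.
(* Chosen so that y^(m+1) / (m+1)! is exactly K / t. *)
pose y := (K * m.+1`!%:R / t) `^ m.+1%:R^-1.
have y0 : 0 < y by rewrite powR_gt0// !mulr_gt0// invr_gt0.
have yX : y ^+ m.+1 = K * m.+1`!%:R / t.
  rewrite -powR_mulrn ?(ltW y0)// -powRrM mulVf// powRr1//.
  by rewrite !mulr_ge0// ?invr_ge0 ltW.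
have -> : 2 * (K * m.+1`!%:R) `^ m.+1%:R^-1 * sigma * t `^ (- m.+1%:R^-1) =
    2 * sigma * y.
  rewrite /y [in RHS]powRM ?invr_ge0 ?mulr_ge0 ?(ltW K0) ?(ltW t0)//.
  by rewrite -(powR_inv1 (ltW t0)) -powRrM mulN1r; ring.
apply: rearrangement_le; first by rewrite !mulr_gt0.
have a0 : 0 < K / t by rewrite divr_gt0.
have := le_integral_abse mu measurableT mexp a0.
under [in leRHS]eq_integral do rewrite gee0_abs ?lee_fin ?expR_ge0//.
move=> /le_trans /(_ intK).
rewrite -lee_pdivlMl// -EFinM invf_div mulfVK ?gt_eqF//.
apply: le_trans; apply: le_measure; rewrite ?inE.
- exact: measurable_gt.
- apply: emeasurable_fun_c_infty => //.
  exact: measurableT_comp.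
move=> x /= yx; split => //.
have yc : y < cmod (f x) / (2 * sigma) by rewrite ltr_pdivlMr ?mulr_gt0// mulrC.
rewrite lee_fin ger0_norm ?expR_ge0//.
apply: le_trans (expR_ge1Dxn m (ltW (lt_trans y0 yc))).
rewrite -[leLHS]add0r lerD// ler_pdivlMr// mulrAC -yX.
by rewrite lerXn2r ?nnegrE ?(ltW y0) ?(ltW (lt_trans y0 yc)) ?(ltW yc).
Qed.

Lemma rearrangement_eq0 (t : R) : mu setT = 1%E -> 1 < t ->
  rearrangement mu f t = 0%E.
Proof.
move=> muT t1; apply/eqP; rewrite eq_le rearrangement_ge0 andbT.
apply/lee_addgt0Pr => e e0; rewrite add0e; apply: rearrangement_le => //.
apply: (@le_trans _ _ 1%E); last by rewrite lee_fin ltW.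
by rewrite -muT; apply: le_measure; rewrite ?inE.
Qed.

(* Where |f| <= sigma / 2, |f|^2 <= sigma^2 / 4; where |f|^2 > M sigma^2,
   |f|^2 <= |f|^4 / (M sigma^2), which the exponential moment controls. In between
   |f|^2 is at most M sigma^2 times the indicator of the event to be bounded. *)
Lemma distr_fun_half_ge : mu setT = 1%E ->
  (\int[mu]_t (cmod (f t) ^+ 2)%:E = (sigma ^+ 2)%:E)%E ->
  ((8 * 16 * 24 * K)^-1%:E <= distr_fun mu f (sigma / 2))%E.
Proof.
(* With this M the tail term 16 * 24 / M * K equals 1/4, whence 1 <= 1/4 + M mu(A) + 1/4 and mu(A)
   >= 1 / (2 M). *)
move=> muT int2; pose M := 4 * 16 * 24 * K; have M0 : 0 < M by rewrite !mulr_gt0.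
set A := [set x | sigma / 2 < cmod (f x)].
have mA : measurable A by exact: measurable_gt.
have s20 : 0 < sigma ^+ 2 by rewrite exprn_gt0.
have key t : cmod (f t) ^+ 2 <= sigma ^+ 2 *
    (1 / 4 + (M * \1_A t + 16 * 24 / M * expR (cmod (f t) / (2 * sigma)))).
  have c0 : 0 <= cmod (f t) by case: (f t) => a b; exact: sqrtr_ge0.
  pose z := cmod (f t) / (2 * sigma).
  have z0 : 0 <= z by rewrite divr_ge0// ?mulr_ge0// ltW.
  have cz : cmod (f t) = 2 * z * sigma by rewrite /z; field; rewrite gt_eqF.
  (* In the scale |f| = 2 sigma z, this yields (2 z)^4 <= 16 * 24 * exp z, the source of the
     constant 16 * 24. *)
  have z4 : z ^+ 4 <= 24 * expR z.
    have := expR_ge1Dxn 3 z0; rewrite (_ : 4`! = 24%N)// => h.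
    by rewrite mulrC -ler_pdivrMr//; apply: le_trans h; rewrite lerDr.
  rewrite -/z cz exprMn mulrC ler_pM2l// indicE.
  have ez : 0 <= 16 * 24 / M * expR z by rewrite !mulr_ge0 ?invr_ge0 ?expR_ge0 ?ltW.
  case: (boolP (t \in A)) => [tA|].
    rewrite mulr1; have [zM|zM] := leP ((2 * z) ^+ 2) M; first lra.
    have : (2 * z) ^+ 2 <= 16 * 24 / M * expR z; last lra.
    rewrite mulrAC ler_pdivlMr//; apply: (@le_trans _ _ (16 * z ^+ 4)); last lra.
    have -> : 16 * z ^+ 4 = (2 * z) ^+ 2 * (2 * z) ^+ 2 by ring.
    by rewrite ler_wpM2l ?sqr_ge0// ltW.
  move=> tA; rewrite mulr0 add0r.
  move: tA; rewrite notin_setE /A/= => /negP; rewrite -leNgt cz => zA.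
  have z2 : 2 * z <= 1 / 2 by rewrite -(ler_pM2r sigma0) (le_trans zA)// mul1r mulrC.
  have : (2 * z) ^+ 2 <= (1 / 2) ^+ 2.
    by rewrite lerXn2r// nnegrE mulr_ge0.
  by move: ez; lra.
have : ((sigma ^+ 2)%:E <= (sigma ^+ 2)%:E *
    ((1 / 4)%:E + (M%:E * mu A + (16 * 24 / M)%:E * K%:E)))%E.
  rewrite -[leLHS]int2.
  apply: (@le_trans _ _ (\int[mu]_t ((sigma ^+ 2)%:E * ((1 / 4)%:E + (M%:E *
      (\1_A t)%:E + (16 * 24 / M)%:E * (expR (cmod (f t) / (2 * sigma)))%:E))))%E).
    apply: ge0_le_integral_nonmeasurable => t _; first by rewrite lee_fin sqr_ge0.
    exact: (key t).
  have c384 : 0 <= 16 * 24 / M by rewrite divr_ge0 ?ltW.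
  have mI : measurable_fun setT (fun t => (\1_A t : R)%:E).
    exact/measurable_EFinP/measurable_indic.
  have mG : measurable_fun setT (fun t => (M%:E * (\1_A t)%:E)%E).
    exact: measurable_funeM.
  have mH : measurable_fun setT (fun t => ((16 * 24 / M)%:E *
      (expR (cmod (f t) / (2 * sigma)))%:E)%E).
    exact: measurable_funeM.
  have G0 t : (0 <= M%:E * (\1_A t)%:E)%E by rewrite mule_ge0 ?lee_fin ?(ltW M0).
  have H0 t : (0 <= (16 * 24 / M)%:E * (expR (cmod (f t) / (2 * sigma)))%:E)%E.
    by rewrite mule_ge0 ?lee_fin ?expR_ge0.
  rewrite ge0_integralZl//; first last.
  - by rewrite lee_fin ltW.
  - by move=> t _; apply: adde_ge0; [rewrite lee_fin divr_ge0|exact: adde_ge0].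
  - by apply: emeasurable_funD => //; exact: emeasurable_funD.
  apply: lee_wpmul2l; first by rewrite lee_fin ltW.
  rewrite ge0_integralD//; first last.
  - exact: emeasurable_funD.
  - by move=> t _; rewrite adde_ge0.
  rewrite integral_cst// muT mule1; apply: leeD => //.
  rewrite ge0_integralD// !ge0_integralZl ?lee_fin// ?(ltW M0)//.
  by rewrite integral_indic// setIT; apply: leeD => //; apply: lee_wpmul2l.
rewrite -[leLHS]mule1 lee_pmul2l ?lte_fin// -EFinM.
rewrite /distr_fun -/A.
have : (0 <= mu A)%E by [].
case: (mu A) => [u| |//].
  move=> _ h.
  have {h} : 1 <= 1 / 4 + (M * u + 16 * 24 / M * K) by exact: h.
  have -> : 16 * 24 / M * K = 1 / 4 by rewrite /M; field; rewrite gt_eqF.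
  move=> h; rewrite lee_fin.
  have -> : (8 * 16 * 24 * K)^-1 = 1 / 2 / M by rewrite /M; field; rewrite gt_eqF.
  by rewrite ler_pdivrMr// mulrC; lra.
by move=> _ _; rewrite leey.
Qed.

(** A level l < sigma / 2 with distribution at most t would, by monotonicity, bound the distribution
    at sigma / 2 by t, below its established lower bound. *)
Lemma rearrangement_ge_half (t : R) : mu setT = 1%E ->
  (\int[mu]_t (cmod (f t) ^+ 2)%:E = (sigma ^+ 2)%:E)%E ->
  0 < t < (8 * 16 * 24 * K)^-1 -> ((sigma / 2)%:E <= rearrangement mu f t)%E.
Proof.
move=> muT int2 /andP[t0 tc]; apply: le_ereal_inf_tmp => _ [l [l0 lt] <-].
rewrite lee_fin leNgt; apply/negP => ls.
have := distr_fun_half_ge muT int2; apply/negP; rewrite -ltNge.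
apply: (@le_lt_trans _ _ t%:E); last by rewrite lte_fin.
apply: le_trans lt; apply: le_measure; rewrite ?inE//; try exact: measurable_gt.
by move=> x /=; exact: lt_trans.
Qed.

End rearrangement_bounds.

(** * Complex Rademacher sums through real and imaginary parts *)

Section complex_rademacher_sums.
Context {R : realType}.
Implicit Types (x : nat -> R[i]) (z : R[i]).

Lemma cmod_ge0 z : 0 <= cmod z.
Proof. by case: z => a b; exact: sqrtr_ge0. Qed.

Lemma sqr_cmod z : cmod z ^+ 2 = complex.Re z ^+ 2 + complex.Im z ^+ 2.
Proof. by case: z => a b; rewrite /cmod/= sqr_sqrtr// addr_ge0 ?sqr_ge0. Qed.

Lemma cmod_le z : cmod z <= `|complex.Re z| + `|complex.Im z|.
Proof.
rewrite -(@ler_pXn2r _ 2)// ?nnegrE ?cmod_ge0 ?addr_ge0//.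
rewrite sqr_cmod sqrrD !real_normK ?num_real// lerD2r lerDl.
by rewrite mulrn_wge0// mulr_ge0.
Qed.

(** The upper index is written [1 + N] to match the form [m + k] of the moment lemmas. *)
Lemma Re_rademacher_sum N x t :
  complex.Re (rademacher_sum N x t) = rsum (fun n => complex.Re (x n)) 1 (1 + N) t.
Proof.
rewrite /rademacher_sum /rsum add1n.
elim/big_rec2: _ => // n b z _ <-; rewrite raddfD/=.
by case: (x n) => u v; rewrite /= mulr0 subr0.
Qed.

Lemma Im_rademacher_sum N x t :
  complex.Im (rademacher_sum N x t) = rsum (fun n => complex.Im (x n)) 1 (1 + N) t.
Proof.
rewrite /rademacher_sum /rsum add1n.
elim/big_rec2: _ => // n b z _ <-; rewrite raddfD/=.
by case: (x n) => u v; rewrite /= mulr0 add0r.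
Qed.

Lemma measurable_cmod_rademacher_sum N x :
  measurable_fun setT (fun t => cmod (rademacher_sum N x t)).
Proof.
have -> : (fun t => cmod (rademacher_sum N x t)) = (fun t => Num.sqrt
    (rsum (fun n => complex.Re (x n)) 1 (1 + N) t ^+ 2 +
     rsum (fun n => complex.Im (x n)) 1 (1 + N) t ^+ 2)).
  apply/funext => t; rewrite -Re_rademacher_sum -Im_rademacher_sum -sqr_cmod.
  by rewrite sqrtr_sqr ger0_norm// cmod_ge0.
apply: measurableT_comp.
  by apply: continuous_measurable_fun; exact: sqrt_continuous.
by apply: measurable_funD; apply: measurable_funX; exact: measurable_rsum.
Qed.

Lemma integral_sqr_cmod_rademacher_sum N x :
  (\int[unit_lebesgue R]_t (cmod (rademacher_sum N x t) ^+ 2)%:E =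
   (\sum_(1 <= n < N.+1) cmod (x n) ^+ 2)%R%:E)%E.
Proof.
under eq_integral do
  rewrite sqr_cmod Re_rademacher_sum Im_rademacher_sum EFinD.
rewrite ge0_integralD//; first last.
- by apply/measurable_EFinP; apply: measurable_funX; exact: measurable_rsum.
- by move=> t _; rewrite lee_fin sqr_ge0.
- by apply/measurable_EFinP; apply: measurable_funX; exact: measurable_rsum.
- by move=> t _; rewrite lee_fin sqr_ge0.
rewrite !integral_sqr_rsum -EFinD -big_split/= add1n; congr EFin.
by apply: eq_bigr => n _; rewrite sqr_cmod.
Qed.

Lemma complex_Lnorm2_rademacher_sum N x :
  complex_Lnorm (unit_lebesgue R) (rademacher_sum N x) 2%:E =
  (Num.sqrt (\sum_(1 <= n < N.+1) cmod (x n) ^+ 2))%:E.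
Proof.
rewrite /complex_Lnorm unlock.
under eq_integral do
  rewrite gee0_abs ?lee_fin ?cmod_ge0// poweR_EFin powR_mulrn ?cmod_ge0//.
rewrite integral_sqr_cmod_rademacher_sum poweR_EFin powR12_sqrt//.
by rewrite sumr_ge0// => n _; rewrite sqr_ge0.
Qed.

Lemma expR_norm_le (y : R) : expR `|y| <= expR y + expR (- y).
Proof. by case: ger0P => _; rewrite ?lerDl ?lerDr expR_ge0. Qed.

(** The bound exp |y| <= exp y + exp (- y) reduces this to two sums, with coefficients a_n and -
    a_n, which have the same squares. *)
Lemma integral_expR_norm_rsum_le (a : nat -> R) m k :
  (\int[unit_lebesgue R]_t (expR `|rsum a m (m + k) t|)%:E <=
   (2 * expR (2 * \sum_(m <= n < m + k) a n ^+ 2))%R%:E)%E.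
Proof.
have mr b : measurable_fun setT (fun t : R => (expR (rsum b m (m + k) t))%:E).
  by apply/measurable_EFinP; apply: measurableT_comp => //; exact: measurable_rsum.
have rN t : rsum (fun n => - a n) m (m + k) t = - rsum a m (m + k) t.
  by rewrite /rsum -sumrN; apply: eq_bigr => n _; rewrite mulNr.
apply: (@le_trans _ _ (\int[unit_lebesgue R]_t ((expR (rsum a m (m + k) t))%:E +
    (expR (rsum (fun n => - a n)%R m (m + k) t))%:E))%E).
  apply: ge0_le_integral_nonmeasurable => t _; first by rewrite lee_fin expR_ge0.
  by rewrite rN -EFinD lee_fin expR_norm_le.
rewrite ge0_integralD//; [|exact: mr..].
rewrite mulr_natl mulr2n EFinD; apply: leeD; first exact: integral_expR_rsum_le.
apply: le_trans (integral_expR_rsum_le _ _ _) _.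
by under eq_bigr do rewrite sqrrN.
Qed.

(** With u = |Re S| / sigma and v = |Im S| / sigma, exp (|S| / (2 sigma)) <= exp (u/2) exp (v/2) <=
    (exp u + exp v) / 2, and each part has expectation at most 2 exp 2. Requiring only an inequality
    for sigma lets it be any positive number when all coefficients vanish. *)
Lemma integral_expR_cmod_rademacher_sum_le N x (sigma : R) : 0 < sigma ->
  \sum_(1 <= n < N.+1) cmod (x n) ^+ 2 <= sigma ^+ 2 ->
  (\int[unit_lebesgue R]_t
     (expR (cmod (rademacher_sum N x t) / (2 * sigma)))%R%:E <=
   (2 * expR 2)%R%:E)%E.
Proof.
move=> s0 xs.
have bound (a : nat -> R) : (forall n, a n ^+ 2 <= cmod (x n) ^+ 2) ->
    (\int[unit_lebesgue R]_t (expR `|rsum (fun n => a n / sigma)%R 1 (1 + N) t|)%:E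
      <= (2 * expR 2)%R%:E)%E.
  move=> ax; apply: le_trans (integral_expR_norm_rsum_le _ _ _) _.
  rewrite lee_fin ler_wpM2l// ler_expR -[leRHS]mulr1 ler_wpM2l// add1n.
  under eq_bigr do rewrite expr_div_n.
  rewrite -mulr_suml ler_pdivrMr ?exprn_gt0// mul1r.
  by apply: le_trans xs; apply: ler_sum => n _.
pose A t := expR `|rsum (fun n => complex.Re (x n) / sigma) 1 (1 + N) t|.
pose B t := expR `|rsum (fun n => complex.Im (x n) / sigma) 1 (1 + N) t|.
have mA : measurable_fun setT A.
  apply: measurableT_comp => //; apply: measurableT_comp => //.
  exact: measurable_rsum.
have mB : measurable_fun setT B.
  apply: measurableT_comp => //; apply: measurableT_comp => //.
  exact: measurable_rsum.
apply: (@le_trans _ _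
    (\int[unit_lebesgue R]_t (2^-1%:E * ((A t)%:E + (B t)%:E)))%E).
  apply: ge0_le_integral_nonmeasurable => t _; first by rewrite lee_fin expR_ge0.
  rewrite -EFinD -EFinM lee_fin /A /B.
  have rs (a : nat -> R) : rsum (fun n => a n / sigma) 1 (1 + N) t =
      rsum a 1 (1 + N) t / sigma.
    by rewrite /rsum mulr_suml; apply: eq_bigr => n _; rewrite mulrAC.
  rewrite !rs -Re_rademacher_sum -Im_rademacher_sum.
  set z := rademacher_sum N x t; rewrite !normrM.
  rewrite [`|sigma^-1|]ger0_norm ?invr_ge0 ?(ltW s0)//.
  set u := `|complex.Re z| / sigma; set v := `|complex.Im z| / sigma.
  have e2 (w : R) : expR w = expR (w / 2) ^+ 2.
    by rewrite expr2 -expRD -splitr.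
  apply: (@le_trans _ _ (expR (u / 2) * expR (v / 2))).
    rewrite -expRD ler_expR ler_pdivrMr ?mulr_gt0//.
    apply: (le_trans (cmod_le z)); rewrite le_eqVlt; apply/orP; left.
    by apply/eqP; rewrite /u /v; field; rewrite gt_eqF.
  rewrite (e2 u) (e2 v).
  have := sqr_ge0 (expR (u / 2) - expR (v / 2)); rewrite sqrrB; lra.
rewrite ge0_integralZl//; first last.
- by move=> t _; rewrite -EFinD lee_fin addr_ge0 ?expR_ge0.
- by apply: emeasurable_funD; exact/measurable_EFinP.
rewrite ge0_integralD//; first last.
- exact/measurable_EFinP.
- by move=> t _; rewrite lee_fin expR_ge0.
- exact/measurable_EFinP.
- by move=> t _; rewrite lee_fin expR_ge0.
rewrite -lee_pdivlMl// invrK -EFinM (mulr_natl (2 * expR 2)) mulr2n EFinD.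
by apply: leeD; apply: bound => n; rewrite sqr_cmod ?lerDl ?lerDr ?sqr_ge0.
Qed.

End complex_rademacher_sums.

(** * Comparison of the Lorentz and L^2 norms *)

Theorem lemma3p3 (R : realType) (p : R) (q : \bar R)
    (hp : 1 < p) (hq : (1%:E <= q)%E) :
  exists c C : R, [/\ 0 < c, 0 < C &
    forall (N : nat) (x : nat -> R[i]), (1 <= N)%N ->
      let S := rademacher_sum N x in
      let L2 := complex_Lnorm (unit_lebesgue R) S 2%:E in
      let Lpq := lorentz_norm (unit_lebesgue R) S p q in
      [/\ (c%:E * L2 <= Lpq)%E,
          (Lpq <= C%:E * L2)%E &
          L2 = (Num.sqrt (\sum_(1 <= n < N.+1) cmod (x n) ^+ 2))%:E]].
Proof.
have p0 : 0 < p by exact: lt_trans hp.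
pose K : R := 2 * expR 2; have K0 : 0 < K by rewrite mulr_gt0// expR_gt0.
(* The moment order m + 1 exceeds p, so its inverse is an admissible exponent b < 1/p. *)
pose m := Num.truncn p.
have mp : m.+1%:R^-1 < p^-1.
  by rewrite ltf_pV2 ?posrE// truncnS_gt.
have [C1 C10 ub] := lorentz_norm_le p0 hq mp.
have c00 : 0 < (8 * 16 * 24 * K)^-1 by rewrite invr_gt0 !mulr_gt0.
have [c1 c10 lb] := lorentz_norm_ge p0 hq c00.
pose B := 2 * (K * m.+1`!%:R) `^ m.+1%:R^-1.
have B0 : 0 < B by rewrite mulr_gt0// powR_gt0// mulr_gt0// ltr0n fact_gt0.
(* The halving reflects the lower bound s / 2 on the rearrangement; B is the factor of sigma in its
   upper bound. *)
exists (c1 / 2), (C1 * B); split; [exact: divr_gt0|exact: mulr_gt0|].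
move=> N x _ S L2 Lpq; rewrite /L2 complex_Lnorm2_rademacher_sum.
set s2 := \sum_(1 <= n < N.+1) _; set s := Num.sqrt s2.
have s20 : 0 <= s2 by rewrite sumr_ge0// => n _; rewrite sqr_ge0.
have ss : s ^+ 2 = s2 by rewrite sqr_sqrtr.
have mS := measurable_cmod_rademacher_sum N x.
have PT := @unit_lebesgueT R.
(* Stated for every sigma >= s, since s itself may be 0 while sigma must be positive. *)
have upper (sigma : R) : 0 < sigma -> s <= sigma ->
    (Lpq <= (C1 * (B * sigma))%:E)%E.
  move=> sigma0 ssigma.
  have intS := @integral_expR_cmod_rademacher_sum_le R N x _ sigma0.
  apply: ub; first by rewrite mulr_ge0 ?ltW.
    move=> t t0; apply: rearrangement_le_powR => //; apply: intS.
    by rewrite -/s2 -ss lerXn2r ?nnegrE ?sqrtr_ge0 ?(ltW sigma0).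
  by move=> t t1; apply: rearrangement_eq0.
split => //.
- have [s0|s0] := leP s 0.
    have -> : s = 0 by apply/eqP; rewrite eq_le s0 sqrtr_ge0.
    rewrite mule0 /Lpq /lorentz_norm; case: q hq {ub lb upper Lpq} => // [r|] _.
      exact: poweR_ge0.
    apply: (@le_trans _ _ ((1 `^ p^-1)%:E * rearrangement (unit_lebesgue R) S 1)%E).
      by rewrite mule_ge0 ?lee_fin ?powR_ge0// rearrangement_ge0.
    by apply: ereal_sup_ubound; exists 1 => //=; rewrite in_itv/= ltr01.
  rewrite -EFinM -mulrA [2^-1 * s]mulrC; apply: lb; first by rewrite divr_ge0 ?ltW.
  move=> t tc; apply: (@rearrangement_ge_half _ _ _ _ _ _ K) => //.
    by apply: integral_expR_cmod_rademacher_sum_le; rewrite ?ss.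
  by rewrite integral_sqr_cmod_rademacher_sum ss.
- rewrite -EFinM -mulrA; have [s0|s0] := leP s 0; last exact: upper.
  have -> : s = 0 by apply/eqP; rewrite eq_le s0 sqrtr_ge0.
  (* For s = 0, taking sigma = e / (C1 B) bounds the Lorentz norm by an arbitrary e > 0. *)
  rewrite !mulr0; apply/lee_addgt0Pr => e e0; rewrite add0e.
  have CB0 : 0 < C1 * B by rewrite mulr_gt0.
  apply: le_trans (upper (e / (C1 * B)) _ _) _.
  + by rewrite divr_gt0.
  + by rewrite (le_trans s0)// divr_ge0 ?ltW.
  + by rewrite lee_fin mulrA mulrC divfK// gt_eqF.
Qed.
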